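(* Let $\mathcal{M}$ be a Type $\mathcal{B}$ symmetric affine surface with non-parallel torsion tensor ($\nabla T\ne0$). Then $\mathcal{M}$ is equivalent under the action of the $ax+b$ gauge group to one of the following 9 structures, with associated parameters $\xi,\eta,\alpha,\beta,\gamma,\delta\in\mathbb{R}$ and $\varepsilon=\pm1$, where $\alpha\ge0$, $\eta+1\neq2\delta$, $\gamma\neq-\frac12$; the torsion is given by $T=(x^1)^{-1}(dx^1\wedge dx^2)\otimes(T^1\partial_{x^1}+T^2\partial_{x^2})$: \begin{enumerate} \item $\tilde\Gamma_{11}{}^1=-2$, $\tilde\Gamma_{11}{}^2=\xi$, $\tilde\Gamma_{12}{}^1=0$, $\tilde\Gamma_{12}{}^2=0$, $\tilde\Gamma_{21}{}^1=-1$, $\tilde\Gamma_{21}{}^2=\xi$, $\tilde\Gamma_{22}{}^1=0$, $\tilde\Gamma_{22}{}^2=1$, $T^1=\frac12$, $T^2=-\frac{\xi}{2}$; $\tilde\rho=\left(\begin{array}{cc}\xi&1\\1&0\end{array}\right)$, $\widetilde{\nabla T}=-\frac12\left(\begin{array}{cc}1&0\\1&0\end{array}\right)$. \item $\tilde\Gamma_{11}{}^1=\eta$, $\tilde\Gamma_{11}{}^2=0$, $\tilde\Gamma_{12}{}^1=0$, $\tilde\Gamma_{12}{}^2=\eta+1$, $\tilde\Gamma_{21}{}^1=0$, $\tilde\Gamma_{21}{}^2=\eta+1-2\delta$, $\tilde\Gamma_{22}{}^1=0$, $\tilde\Gamma_{22}{}^2=0$, $T^1=0$, $T^2=\delta$;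 $\rho=0$, $\widetilde{\nabla T}=\left(\begin{array}{cc}0&-\delta(1+\eta)\\0&0\end{array}\right)$. \item $\tilde\Gamma_{11}{}^1=2\beta-2$, $\tilde\Gamma_{11}{}^2=1$, $\tilde\Gamma_{12}{}^1=0$, $\tilde\Gamma_{12}{}^2=2\beta-1$, $\tilde\Gamma_{21}{}^1=0$, $\tilde\Gamma_{21}{}^2=-1$, $\tilde\Gamma_{22}{}^1=0$, $\tilde\Gamma_{22}{}^2=0$, $T^1=0$, $T^2=\beta$; $\rho=0$, $\widetilde{\nabla T}=\left(\begin{array}{cc}0&-\beta(2\beta-1)\\0&0\end{array}\right)$. \item $\tilde\Gamma_{11}{}^1=0$, $\tilde\Gamma_{11}{}^2=\xi$, $\tilde\Gamma_{12}{}^1=1$, $\tilde\Gamma_{12}{}^2=2\beta$, $\tilde\Gamma_{21}{}^1=0$, $\tilde\Gamma_{21}{}^2=0$, $\tilde\Gamma_{22}{}^1=0$, $\tilde\Gamma_{22}{}^2=0$, $T^1=\frac12$, $T^2=\beta$; $\rho=0$, $\widetilde{\nabla T}=\frac12\left(\begin{array}{cc}-1&\xi-2\beta\\0&0\end{array}\right)$. \item $\tilde\Gamma_{11}{}^1=\xi$, $\tilde\Gamma_{11}{}^2=0$, $\tilde\Gamma_{12}{}^1=0$, $\tilde\Gamma_{12}{}^2=2\beta$, $\tilde\Gamma_{21}{}^1=0$, $\tilde\Gamma_{21}{}^2=0$, $\tilde\Gamma_{22}{}^1=0$, $\tilde\Gamma_{22}{}^2=0$, $T^1=0$, $T^2=\beta$;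 $\rho=0$, $\widetilde{\nabla T}=\left(\begin{array}{cc}0&-\beta(1+\xi)\\0&0\end{array}\right)$. \item $\tilde\Gamma_{11}{}^1=2\beta$, $\tilde\Gamma_{11}{}^2=1$, $\tilde\Gamma_{12}{}^1=0$, $\tilde\Gamma_{12}{}^2=2\beta$, $\tilde\Gamma_{21}{}^1=0$, $\tilde\Gamma_{21}{}^2=0$, $\tilde\Gamma_{22}{}^1=0$, $\tilde\Gamma_{22}{}^2=0$, $T^1=0$, $T^2=\beta$; $\rho=0$, $\widetilde{\nabla T}=\left(\begin{array}{cc}0&-\beta(1+2\beta)\\0&0\end{array}\right)$. \item $\tilde\Gamma_{11}{}^1=\xi$, $\tilde\Gamma_{11}{}^2=0$, $\tilde\Gamma_{12}{}^1=2\alpha$, $\tilde\Gamma_{12}{}^2=-1$, $\tilde\Gamma_{21}{}^1=0$, $\tilde\Gamma_{21}{}^2=0$, $\tilde\Gamma_{22}{}^1=\varepsilon$, $\tilde\Gamma_{22}{}^2=0$, $T^1=\alpha$, $T^2=-\frac12$; $\tilde\rho=\left(\begin{array}{cc}0&0\\0&\varepsilon\xi\end{array}\right)$, $\widetilde{\nabla T}=-\frac12\left(\begin{array}{cc}2\alpha&-\xi-1\\\varepsilon&0\end{array}\right)$. \item $\tilde\Gamma_{11}{}^1=2\gamma+1$, $\tilde\Gamma_{11}{}^2=0$, $\tilde\Gamma_{12}{}^1=2\alpha$, $\tilde\Gamma_{12}{}^2=2\gamma$, $\tilde\Gamma_{21}{}^1=0$, $\tilde\Gamma_{21}{}^2=0$,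 $\tilde\Gamma_{22}{}^1=\varepsilon$, $\tilde\Gamma_{22}{}^2=0$, $T^1=\alpha$, $T^2=\gamma$; $\rho=0$, $\widetilde{\nabla T}=\left(\begin{array}{cc}-\alpha&-2\gamma(\gamma+1)\\\varepsilon\gamma&0\end{array}\right)$. \item $\tilde\Gamma_{11}{}^1=-1$, $\tilde\Gamma_{11}{}^2=-2\varepsilon\alpha(2\gamma+1)$, $\tilde\Gamma_{12}{}^1=2\alpha$, $\tilde\Gamma_{12}{}^2=-1$, $\tilde\Gamma_{21}{}^1=0$, $\tilde\Gamma_{21}{}^2=-2\gamma-1$, $\tilde\Gamma_{22}{}^1=\varepsilon$, $\tilde\Gamma_{22}{}^2=0$, $T^1=\alpha$, $T^2=\gamma$; $\tilde\rho=\left(\begin{array}{cc}-2\gamma-1&0\\0&-\varepsilon\end{array}\right)$, $\widetilde{\nabla T}=\left(\begin{array}{cc}2\alpha\gamma&-2\varepsilon\alpha^2(2\gamma+1)\\\varepsilon\gamma&-\alpha(2\gamma+1)\end{array}\right)$. \end{enumerate} Moreover, no two different surfaces in this classification (different families, or the same family with different parameter values) are linearly equivalent.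
   Context: An affine surface is a pair $\mathcal{M}=(M,\nabla)$ where $M$ is a smooth 2-dimensional manifold and $\nabla$ is a connection on the tangent bundle of $M$; the torsion is permitted to be non-zero. The torsion tensor is $T(X,Y):=\frac12(\nabla_XY-\nabla_YX-[X,Y])$. The curvature operator is $R(X,Y):=\nabla_X\nabla_Y-\nabla_Y\nabla_X-\nabla_{[X,Y]}$ and the Ricci tensor is $\rho(X,Y):=\operatorname{Trace}(Z\mapsto R(Z,X)Y)$. $\mathcal{M}$ is symmetric if $\nabla R=0$, or equivalently (in dimension 2) if $\nabla\rho=0$. In local coordinates $\nabla_{\partial_{x^i}}\partial_{x^j}=\Gamma_{ij}{}^k\partial_{x^k}$ (in general $\Gamma_{ij}{}^k\ne\Gamma_{ji}{}^k$). In coordinates, $T=\frac12(dx^1\wedge dx^2)\otimes\{(\Gamma_{12}{}^1-\Gamma_{21}{}^1)\partial_{x^1}+(\Gamma_{12}{}^2-\Gamma_{21}{}^2)\partial_{x^2}\}$. A geometry is of Type $\mathcal{B}$ if it has coordinates $(x^1,x^2)$ with $x^1>0$ in which $\Gamma_{ij}{}^k=\frac1{x^1}\tilde\Gamma_{ij}{}^k$ with $\tilde\Gamma_{ij}{}^k\in\mathbb{R}$ constant; a Type $\mathcal{B}$ geometry is thus specified by its 8 constants $\tilde\Gamma_{ij}{}^k$, and may be regarded as a connection on $\mathbb{R}^+\times\mathbb{R}$. The quantities $\tilde\rho$, $\tilde T$, $\widetilde{\nabla T}$ are the values of $\rho$, $T$, $\nabla T$ at $x^1=1$; one has $\rho=(x^1)^{-2}\tilde\rho$,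 $T=(x^1)^{-1}\tilde T$, $\nabla T=(x^1)^{-2}\widetilde{\nabla T}$. The matrix $\tilde\rho$ has entries $\tilde\rho_{ij}=\tilde\rho(\partial_{x^i},\partial_{x^j})$; the matrix $\widetilde{\nabla T}$ has as $(i,k)$ entry (row $i$, column $k$) the coefficient of $(dx^1\wedge dx^2)\otimes\partial_{x^k}$ in $\nabla_{\partial_{x^i}}T$ at $x^1=1$. The $ax+b$ group acts on the set of Type $\mathcal{B}$ geometries by the linear changes of coordinates $(x^1,x^2)\mapsto(x^1,ax^2+bx^1)$ with $a,b\in\mathbb{R}$, $a\neq0$. Two Type $\mathcal{B}$ geometries are linearly equivalent (equivalent under the $ax+b$ gauge group) if they lie in the same orbit of this action. *)

(* Defs.v *)
(* Stdlib reals with Coquelicot derivatives. *)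
From Stdlib Require Import Reals.
From Coquelicot Require Import Coquelicot.

Open Scope R_scope.

Inductive idx : Set := I1 | I2.

Definition sum2 (f : idx -> R) : R := f I1 + f I2.

(* Fields are total functions of (x1, x2); they are only ever examined on the
   open half-plane 0 < x1. *)
Definition point : Type := (R * R)%type.
Definition in_domain (x : point) : Prop := 0 < fst x.

Definition vfield : Type := point -> idx -> R.

(* [Gam x i j k] is the Christoffel symbol of nabla_{d_i} d_j = Gam_ij^k d_k;
   no symmetry in [i], [j] is assumed. *)
Definition connection : Type := point -> idx -> idx -> idx -> R.

Definition partial (i : idx) (f : point -> R) (x : point) : R :=
  match i with
  | I1 => Derive (fun t => f (t, snd x)) (fst x)
  | I2 => Derive (fun t => f (fst x, t)) (snd x)
  end.

Definition coord_field (i : idx) : vfield := fun _ k =>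
  match i, k with
  | I1, I1 | I2, I2 => 1
  | _, _ => 0
  end.

Definition cov (Gam : connection) (X Y : vfield) : vfield := fun x k =>
  sum2 (fun i => X x i *
    (partial i (fun y => Y y k) x + sum2 (fun j => Gam x i j k * Y x j))).

Definition bracket (X Y : vfield) : vfield := fun x k =>
  sum2 (fun i => X x i * partial i (fun y => Y y k) x
               - Y x i * partial i (fun y => X y k) x).

(* The torsion is normalised with the factor 1/2. *)
Definition torsion (Gam : connection) (X Y : vfield) : vfield := fun x k =>
  / 2 * (cov Gam X Y x k - cov Gam Y X x k - bracket X Y x k).

Definition curvature (Gam : connection) (X Y Z : vfield) : vfield := fun x k =>
  cov Gam X (cov Gam Y Z) x k - cov Gam Y (cov Gam X Z) x k
  - cov Gam (bracket X Y) Z x k.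

(* The trace of Z |-> R(Z, X) Y. *)
Definition ricci (Gam : connection) (X Y : vfield) (x : point) : R :=
  sum2 (fun k => curvature Gam (coord_field k) X Y x k).

(* (nabla_V R)(X, Y) Z *)
Definition nabla_curvature (Gam : connection) (V X Y Z : vfield) : vfield :=
  fun x k =>
  cov Gam V (curvature Gam X Y Z) x k
  - curvature Gam (cov Gam V X) Y Z x k
  - curvature Gam X (cov Gam V Y) Z x k
  - curvature Gam X Y (cov Gam V Z) x k.

(* (nabla_V T)(X, Y) *)
Definition nabla_torsion (Gam : connection) (V X Y : vfield) : vfield :=
  fun x k =>
  cov Gam V (torsion Gam X Y) x k
  - torsion Gam (cov Gam V X) Y x k
  - torsion Gam X (cov Gam V Y) x k.

Definition symmetric_surface (Gam : connection) : Prop :=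
  forall x, in_domain x -> forall l i j k m : idx,
    nabla_curvature Gam (coord_field l) (coord_field i) (coord_field j)
      (coord_field k) x m = 0.

Definition parallel_torsion (Gam : connection) : Prop :=
  forall x, in_domain x -> forall l i j k : idx,
    nabla_torsion Gam (coord_field l) (coord_field i) (coord_field j) x k = 0.

(* With dx1 /\ dx2 (d_1, d_2) = 1, the coefficient of (dx1 /\ dx2) (x) d_k in
   a vector-valued 2-form is its k-th component on (d_1, d_2). *)
Definition torsion_coef (Gam : connection) (x : point) (k : idx) : R :=
  torsion Gam (coord_field I1) (coord_field I2) x k.

Definition nabla_torsion_coef
    (Gam : connection) (x : point) (i k : idx) : R :=
  nabla_torsion Gam (coord_field i) (coord_field I1) (coord_field I2) x k.

Definition ricci_coef (Gam : connection) (x : point) (i j : idx) : R :=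
  ricci Gam (coord_field i) (coord_field j) x.

(* A Type B geometry is given by its 8 constants [G i j k]. *)
Definition typeB_data : Type := idx -> idx -> idx -> R.

Definition typeB (G : typeB_data) : connection := fun x i j k =>
  G i j k / fst x.

(* The coordinate change y = (x1, a x2 + b x1): [jac a b k r] is dy^k/dx^r and
   [jac_inv a b p i] is dx^p/dy^i. *)
Definition jac (a b : R) (k r : idx) : R :=
  match k, r with
  | I1, I1 => 1
  | I1, I2 => 0
  | I2, I1 => b
  | I2, I2 => a
  end.

Definition jac_inv (a b : R) (p i : idx) : R :=
  match p, i with
  | I1, I1 => 1
  | I1, I2 => 0
  | I2, I1 => - b / a
  | I2, I2 => / a
  end.

(* The transformation law of Christoffel symbols.  The change of coordinates is
   linear, so there is no second-derivative term; it fixes x1, so the factor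
   1/x1 is unchanged and the law can be written on the constants. *)
Definition gauge (a b : R) (G : typeB_data) : typeB_data := fun i j k =>
  sum2 (fun p => sum2 (fun q => sum2 (fun r =>
    jac_inv a b p i * jac_inv a b q j * jac a b k r * G p q r))).

Definition linearly_equivalent (G H : typeB_data) : Prop :=
  exists a b : R, a <> 0 /\ forall i j k, H i j k = gauge a b G i j k.

Definition vec2 (v1 v2 : R) (k : idx) : R :=
  match k with I1 => v1 | I2 => v2 end.

Definition mat2 (m11 m12 m21 m22 : R) (i j : idx) : R :=
  match i with I1 => vec2 m11 m12 j | I2 => vec2 m21 m22 j end.

(* [gijk] is the constant with lower indices i, j and upper index k. *)
Definition mk_data (g111 g112 g121 g122 g211 g212 g221 g222 : R) : typeB_data :=
  fun i j k =>
  match i with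
  | I1 => mat2 g111 g112 g121 g122 j k
  | I2 => mat2 g211 g212 g221 g222 j k
  end.

(* The nine families with their parameters; [eps] stands for a sign. *)
Inductive model : Type :=
  | M1 (xi : R)
  | M2 (eta delta : R)
  | M3 (beta : R)
  | M4 (xi beta : R)
  | M5 (xi beta : R)
  | M6 (beta : R)
  | M7 (xi alpha eps : R)
  | M8 (alpha gamma eps : R)
  | M9 (alpha gamma eps : R).

Definition is_sign (eps : R) : Prop := eps = 1 \/ eps = -1.

Definition admissible (m : model) : Prop :=
  match m with
  | M2 eta delta => eta + 1 <> 2 * delta
  | M7 _ alpha eps => 0 <= alpha /\ is_sign eps
  | M8 alpha gamma eps | M9 alpha gamma eps =>
      0 <= alpha /\ gamma <> - / 2 /\ is_sign eps
  | _ => True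
  end.

Definition model_data (m : model) : typeB_data :=
  match m with
  | M1 xi => mk_data (-2) xi 0 0 (-1) xi 0 1
  | M2 eta delta => mk_data eta 0 0 (eta + 1) 0 (eta + 1 - 2 * delta) 0 0
  | M3 beta => mk_data (2 * beta - 2) 1 0 (2 * beta - 1) 0 (-1) 0 0
  | M4 xi beta => mk_data 0 xi 1 (2 * beta) 0 0 0 0
  | M5 xi beta => mk_data xi 0 0 (2 * beta) 0 0 0 0
  | M6 beta => mk_data (2 * beta) 1 0 (2 * beta) 0 0 0 0
  | M7 xi alpha eps => mk_data xi 0 (2 * alpha) (-1) 0 0 eps 0
  | M8 alpha gamma eps =>
      mk_data (2 * gamma + 1) 0 (2 * alpha) (2 * gamma) 0 0 eps 0
  | M9 alpha gamma eps =>
      mk_data (-1) (- 2 * eps * alpha * (2 * gamma + 1)) (2 * alpha) (-1)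
        0 (- 2 * gamma - 1) eps 0
  end.

Definition model_torsion (m : model) : idx -> R :=
  match m with
  | M1 xi => vec2 (/ 2) (- xi / 2)
  | M2 _ delta => vec2 0 delta
  | M3 beta => vec2 0 beta
  | M4 _ beta => vec2 (/ 2) beta
  | M5 _ beta => vec2 0 beta
  | M6 beta => vec2 0 beta
  | M7 _ alpha _ => vec2 alpha (- / 2)
  | M8 alpha gamma _ => vec2 alpha gamma
  | M9 alpha gamma _ => vec2 alpha gamma
  end.

Definition model_ricci (m : model) : idx -> idx -> R :=
  match m with
  | M1 xi => mat2 xi 1 1 0
  | M7 xi _ eps => mat2 0 0 0 (eps * xi)
  | M9 _ gamma eps => mat2 (- 2 * gamma - 1) 0 0 (- eps)
  | M2 _ _ | M3 _ | M4 _ _ | M5 _ _ | M6 _ | M8 _ _ _ => mat2 0 0 0 0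
  end.

Definition model_nabla_torsion (m : model) : idx -> idx -> R :=
  match m with
  | M1 _ => mat2 (- / 2) 0 (- / 2) 0
  | M2 eta delta => mat2 0 (- delta * (1 + eta)) 0 0
  | M3 beta => mat2 0 (- beta * (2 * beta - 1)) 0 0
  | M4 xi beta => mat2 (- / 2) ((xi - 2 * beta) / 2) 0 0
  | M5 xi beta => mat2 0 (- beta * (1 + xi)) 0 0
  | M6 beta => mat2 0 (- beta * (1 + 2 * beta)) 0 0
  | M7 xi alpha eps =>
      mat2 (- / 2 * (2 * alpha)) (- / 2 * (- xi - 1)) (- / 2 * eps) 0
  | M8 alpha gamma eps =>
      mat2 (- alpha) (- 2 * gamma * (gamma + 1)) (eps * gamma) 0
  | M9 alpha gamma eps =>
      mat2 (2 * alpha * gamma) (- 2 * eps * alpha ^ 2 * (2 * gamma + 1))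
        (eps * gamma) (- alpha * (2 * gamma + 1))
  end.

(* Main.v *)
Require Import Defs.
From Stdlib Require Import FunctionalExtensionality Reals Lra Lia.
From Coquelicot Require Import Coquelicot.
Open Scope R_scope.

(** Every field built from a Type B connection and the coordinate frame has the
    form [x1^-n u] with [u] constant, and covariant differentiation preserves
    this form, so all tensors become polynomials in the eight constants and
    symmetry becomes eight equations [nabla rho = 0].  Write
    [nabla_2 d_2 = (g d_1 + h d_2) / x1].  If [g <> 0], a shear normalises
    [h = 0] and the equations lead to the families 7 to 9; if [g = 0 <> h] only
    family 1 survives; if [g = h = 0], then [nabla_2 d_1] is a multiple of [d_2]
    and one obtains the families 2 to 6, the one remaining solution having
    parallel torsion.  The same components, read off in turn, determine the
    family and its parameters. *)

(** * Calculus of homogeneous fields on the half-plane *)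

Definition homog (n : nat) (u : idx -> R) (X : vfield) : Prop :=
  forall x, in_domain x -> forall k, X x k = u k / fst x ^ n.

Definition frame (i k : idx) : R := coord_field i (1, 0) k.

Lemma homog_coord_field i : homog 0 (frame i) (coord_field i).
Proof.
  intros x Hx k; unfold frame, coord_field; simpl.
  destruct i, k; lra.
Qed.

Lemma homog_sub n u v X Y :
  homog n u X -> homog n v Y ->
  homog n (fun k => u k - v k) (fun x k => X x k - Y x k).
Proof.
  intros HX HY x Hx k; rewrite HX, HY by assumption.
  unfold Rdiv; ring.
Qed.

Lemma homog_scal n c u X :
  homog n u X -> homog n (fun k => c * u k) (fun x k => c * X x k).
Proof.
  intros HX x Hx k; rewrite HX by assumption.
  unfold Rdiv; ring.
Qed.

Lemma homog_partial n u X i x k :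
  homog n u X -> in_domain x ->
  partial i (fun y => X y k) x
  = match i with I1 => - INR n * u k / fst x ^ S n | I2 => 0 end.
Proof.
  intros HX Hx; assert (Hx' := Hx); unfold in_domain in Hx'.
  destruct i; simpl partial.
  - apply is_derive_unique.
    apply is_derive_ext_loc with (fun t => u k / t ^ n).
    (* The homogeneous form is known only for [0 < x1], an open condition, so equality near the
       point suffices. *)
    + apply (locally_interval _ (fst x) 0 p_infty); simpl; trivial.
      intros y Hy _; symmetry; apply (HX (y, snd x)); exact Hy.
    + assert (fst x <> 0) by lra.
      auto_derive.
      * now apply pow_nonzero.
      * destruct n as [|n]; [simpl; field; assumption|].
        replace (pred (S n)) with n by reflexivity.
        rewrite <- !tech_pow_Rmult; field.
        split; [now apply pow_nonzero | assumption].
  - rewrite Derive_ext with (g := fun _ => u k / fst x ^ n).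
    + apply Derive_const.
    + intro t; apply (HX (fst x, t)); exact Hx.
Qed.

(* [m] is the degree of the field with coefficients [v]: [x1^-m] has derivative
   [- m x1^-(m+1)]. *)
Definition hcov (G : typeB_data) (m : nat) (u v : idx -> R) (k : idx) : R :=
  - INR m * u I1 * v k
  + sum2 (fun i => sum2 (fun j => u i * G i j k * v j)).

Definition hbracket (n m : nat) (u v : idx -> R) (k : idx) : R :=
  - INR m * u I1 * v k + INR n * v I1 * u k.

Lemma homog_cov G n m u v X Y :
  homog n u X -> homog m v Y ->
  homog (S (n + m)) (hcov G m u v) (cov (typeB G) X Y).
Proof.
  intros HX HY x Hx k; unfold cov, sum2, hcov, typeB, sum2.
  rewrite !(homog_partial _ _ _ _ _ _ HY Hx), !HX, !HY by assumption.
  assert (fst x <> 0) by (unfold in_domain in Hx; lra).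
  rewrite <- !tech_pow_Rmult, pow_add; field.
  repeat split; trivial; now apply pow_nonzero.
Qed.

Lemma homog_bracket n m u v X Y :
  homog n u X -> homog m v Y ->
  homog (S (n + m)) (hbracket n m u v) (bracket X Y).
Proof.
  intros HX HY x Hx k; unfold bracket, sum2, hbracket.
  rewrite !(homog_partial _ _ _ _ _ _ HY Hx), !(homog_partial _ _ _ _ _ _ HX Hx),
    !HX, !HY by assumption.
  assert (fst x <> 0) by (unfold in_domain in Hx; lra).
  rewrite <- !tech_pow_Rmult, pow_add; field.
  repeat split; trivial; now apply pow_nonzero.
Qed.

Definition htorsion G (n m : nat) (u v : idx -> R) (k : idx) : R :=
  / 2 * (hcov G m u v k - hcov G n v u k - hbracket n m u v k).

Lemma homog_torsion G n m u v X Y :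
  homog n u X -> homog m v Y ->
  homog (S (n + m)) (htorsion G n m u v) (torsion (typeB G) X Y).
Proof.
  intros HX HY.
  apply homog_scal, homog_sub; [apply homog_sub|].
  - now apply homog_cov.
  - rewrite Nat.add_comm; now apply homog_cov.
  - now apply homog_bracket.
Qed.

Definition hcurvature G (n m p : nat) (u v w : idx -> R) (k : idx) : R :=
  hcov G (S (m + p)) u (hcov G p v w) k - hcov G (S (n + p)) v (hcov G p u w) k
  - hcov G p (hbracket n m u v) w k.

Lemma homog_curvature G n m p u v w X Y Z :
  homog n u X -> homog m v Y -> homog p w Z ->
  homog (S (S (n + m + p))) (hcurvature G n m p u v w) (curvature (typeB G) X Y Z).
Proof.
  intros HX HY HZ.
  apply homog_sub; [apply homog_sub|].
  - replace (S (S (n + m + p))) with (S (n + S (m + p))) by lia.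
    now apply homog_cov; [|apply homog_cov].
  - replace (S (S (n + m + p))) with (S (m + S (n + p))) by lia.
    now apply homog_cov; [|apply homog_cov].
  - replace (S (S (n + m + p))) with (S (S (n + m) + p)) by lia.
    now apply homog_cov; [apply homog_bracket|].
Qed.

(** The numerals are degrees: coordinate fields have degree 0, and a torsion or covariant derivative
    of two of them has degree 1. *)
Definition hnabla_torsion G (l i j k : idx) : R :=
  hcov G 1 (frame l) (htorsion G 0 0 (frame i) (frame j)) k
  - htorsion G 1 0 (hcov G 0 (frame l) (frame i)) (frame j) k
  - htorsion G 0 1 (frame i) (hcov G 0 (frame l) (frame j)) k.

Lemma homog_nabla_torsion G l i j :
  homog 2 (hnabla_torsion G l i j)
    (nabla_torsion (typeB G) (coord_field l) (coord_field i) (coord_field j)).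
Proof.
  assert (E := homog_coord_field).
  apply homog_sub; [apply homog_sub|].
  - apply (homog_cov G 0 1); [|apply (homog_torsion G 0 0)]; apply E.
  - apply (homog_torsion G 1 0); [apply (homog_cov G 0 0)|]; apply E.
  - apply (homog_torsion G 0 1); [|apply (homog_cov G 0 0)]; apply E.
Qed.

Definition hnabla_curvature G (l i j k m : idx) : R :=
  hcov G 2 (frame l) (hcurvature G 0 0 0 (frame i) (frame j) (frame k)) m
  - hcurvature G 1 0 0 (hcov G 0 (frame l) (frame i)) (frame j) (frame k) m
  - hcurvature G 0 1 0 (frame i) (hcov G 0 (frame l) (frame j)) (frame k) m
  - hcurvature G 0 0 1 (frame i) (frame j) (hcov G 0 (frame l) (frame k)) m.

Lemma homog_nabla_curvature G l i j k :
  homog 3 (hnabla_curvature G l i j k)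
    (nabla_curvature (typeB G) (coord_field l) (coord_field i) (coord_field j)
       (coord_field k)).
Proof.
  assert (E := homog_coord_field).
  assert (C := fun l k => homog_cov G 0 0 _ _ _ _ (E l) (E k)).
  apply homog_sub; [apply homog_sub; [apply homog_sub|]|].
  - apply (homog_cov G 0 2); [|apply (homog_curvature G 0 0 0)]; apply E.
  - apply (homog_curvature G 1 0 0); [apply C| |]; apply E.
  - apply (homog_curvature G 0 1 0); [|apply C|]; apply E.
  - apply (homog_curvature G 0 0 1); [| |apply C]; apply E.
Qed.

Definition hricci G (i j : idx) : R :=
  sum2 (fun k => hcurvature G 0 0 0 (frame k) (frame i) (frame j) k).

Lemma ricci_typeB G i j x :
  in_domain x -> ricci_coef (typeB G) x i j = hricci G i j / fst x ^ 2.
Proof.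
  intro Hx; unfold ricci_coef, ricci, hricci, sum2.
  assert (E := homog_coord_field).
  rewrite !(homog_curvature G 0 0 0 _ _ _ _ _ _ (E _) (E i) (E j) x Hx).
  simpl Nat.add; unfold Rdiv; ring.
Qed.

Ltac hexpand :=
  unfold hnabla_curvature, hnabla_torsion, hricci, hcurvature, htorsion, hbracket,
    hcov, frame, coord_field, sum2; simpl.

Lemma model_invariants m x i k :
  admissible m -> in_domain x ->
  torsion_coef (typeB (model_data m)) x k = / fst x * model_torsion m k /\
  ricci_coef (typeB (model_data m)) x i k = / (fst x) ^ 2 * model_ricci m i k /\
  nabla_torsion_coef (typeB (model_data m)) x i k
    = / (fst x) ^ 2 * model_nabla_torsion m i k.
Proof.
  intros Hm Hx; assert (E := homog_coord_field).
  rewrite ricci_typeB by assumption.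
  unfold torsion_coef, nabla_torsion_coef.
  rewrite (homog_torsion _ 0 0 _ _ _ _ (E I1) (E I2) x Hx),
    (homog_nabla_torsion _ i I1 I2 x Hx).
  unfold Rdiv; rewrite pow_1, !(Rmult_comm _ (/ _)).
  cut (htorsion (model_data m) 0 0 (frame I1) (frame I2) k = model_torsion m k /\
       hricci (model_data m) i k = model_ricci m i k /\
       hnabla_torsion (model_data m) i I1 I2 k = model_nabla_torsion m i k).
  { intros (-> & -> & ->); auto. }
  (* Substituting the two signs disposes of identities that rely on [eps ^ 2 = 1]. *)
  destruct m; simpl in Hm; unfold is_sign in Hm;
    repeat match goal with
      | H : _ /\ _ |- _ => destruct H
      | H : _ = 1 \/ _ |- _ => destruct H; subst
      end;
    destruct i, k; hexpand; repeat split; field.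
Qed.

(** * The symmetry equations and their tensoriality *)

(* [hricci] multiplied out. *)
Definition ricci_poly (G : typeB_data) (i j : idx) : R :=
  match i with
  | I1 => sum2 (fun m => G I1 j m * G I2 m I2 - G I2 j m * G I1 m I2) + G I2 j I2
  | I2 => sum2 (fun m => G I2 j m * G I1 m I1 - G I1 j m * G I2 m I1) - G I2 j I1
  end.

(* In dimension two the curvature is determined by [rho], so symmetry amounts to
   the vanishing of these eight numbers. *)
Definition nabla_ricci (G : typeB_data) (l i j : idx) : R :=
  - frame l I1 * 2 * ricci_poly G i j
  - sum2 (fun m => G l i m * ricci_poly G m j + G l j m * ricci_poly G i m).

(** Contraction commutes with nabla: tracing nabla R over its first argument gives nabla rho. It is
    read at [x1 = 1], and the factor 2 in [nabla_ricci] comes from differentiating [x1^-2]. *)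
Lemma symmetric_nabla_ricci G :
  symmetric_surface (typeB G) -> forall l i j, nabla_ricci G l i j = 0.
Proof.
  intros HG l i j.
  assert (Hx : in_domain (1, 0)) by (unfold in_domain; simpl; lra).
  assert (H : forall i' k m, hnabla_curvature G l i' i k m = 0).
  { intros i' k m; specialize (HG _ Hx l i' i k m).
    rewrite (homog_nabla_curvature G l i' i k _ Hx) in HG.
    simpl in HG; lra. }
  transitivity (sum2 (fun k => hnabla_curvature G l k i j k)).
  - unfold nabla_ricci, ricci_poly; destruct l, i, j; hexpand; ring.
  - unfold sum2; rewrite !H; ring.
Qed.

(** Both rho and nabla rho are tensors and a shear is linear, so the symmetry equations survive the
    normalisation [h = 0]. *)
Lemma ricci_shift b G i j :
  ricci_poly (gauge 1 b G) i j
  = sum2 (fun p => sum2 (fun q =>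
      jac_inv 1 b p i * jac_inv 1 b q j * ricci_poly G p q)).
Proof.
  unfold ricci_poly, gauge, jac, jac_inv, sum2, Rdiv; rewrite Rinv_1.
  destruct i, j; ring.
Qed.

Lemma nabla_ricci_shift b G l i j :
  nabla_ricci (gauge 1 b G) l i j
  = sum2 (fun p => sum2 (fun q => sum2 (fun r =>
      jac_inv 1 b p l * jac_inv 1 b q i * jac_inv 1 b r j * nabla_ricci G p q r))).
Proof.
  unfold nabla_ricci, sum2; rewrite !ricci_shift.
  unfold gauge, jac, jac_inv, sum2, Rdiv, frame, coord_field; rewrite Rinv_1.
  destruct l, i, j; ring.
Qed.

Lemma linearly_equivalent_trans G H K :
  linearly_equivalent G H -> linearly_equivalent H K -> linearly_equivalent G K.
Proof.
  intros (a & b & Ha & HH) (a' & b' & Ha' & HK).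
  exists (a' * a), (a' * b + b'); split; [now apply Rmult_integral_contrapositive|].
  intros i j k; rewrite HK; unfold gauge at 1, sum2; rewrite !HH.
  unfold gauge, sum2; destruct i, j, k; simpl; field; auto.
Qed.

(** * Normal forms under shears and rescalings *)

Ltac gauge_eqs :=
  intros [] [] []; unfold gauge, jac, jac_inv, sum2; simpl; try (field; lra).

(** Rescaling [x2] by [a] divides the constant [g] by [a ^ 2] and [c] by [a]. Taking [a] of modulus
    [sqrt (Rabs g)] leaves a sign, and the free sign of [a] yields [0 <= alpha]. *)
Lemma sign_decomposition g c :
  g <> 0 -> exists a eps, a <> 0 /\ is_sign eps /\ 0 <= c / a /\ g = eps * a ^ 2.
Proof.
  intro Hg.
  assert (Hs : 0 < sqrt (Rabs g)) by now apply sqrt_lt_R0, Rabs_pos_lt.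
  assert (Hs2 : sqrt (Rabs g) ^ 2 = Rabs g).
  { simpl; rewrite Rmult_1_r; apply sqrt_sqrt, Rabs_pos. }
  assert (He : exists eps, is_sign eps /\ g = eps * Rabs g).
  { unfold is_sign, Rabs; destruct (Rcase_abs g); [exists (-1)|exists 1]; split; auto; lra. }
  destruct He as (eps & He & Heg).
  destruct (Rle_or_lt 0 c) as [Hc|Hc].
  - exists (sqrt (Rabs g)), eps; repeat split; trivial; try (rewrite ?Hs2; lra).
    now apply Rdiv_le_0_compat.
  - exists (- sqrt (Rabs g)), eps; repeat split; trivial; try lra.
    + replace (c / - sqrt (Rabs g)) with (- c / sqrt (Rabs g)) by (field; lra).
      apply Rdiv_le_0_compat; lra.
    + replace ((- sqrt (Rabs g)) ^ 2) with (sqrt (Rabs g) ^ 2) by ring.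
      now rewrite Hs2.
Qed.

Ltac nabla_ricci_eqs H :=
  pose proof (H I1 I1 I1); pose proof (H I1 I1 I2); pose proof (H I1 I2 I1);
  pose proof (H I1 I2 I2); pose proof (H I2 I1 I1); pose proof (H I2 I1 I2);
  pose proof (H I2 I2 I1); pose proof (H I2 I2 I2); clear H;
  unfold nabla_ricci, ricci_poly, frame, coord_field, sum2 in *; simpl in *.

Lemma Rmult_cancel_0 x y : x <> 0 -> x * y = 0 -> y = 0.
Proof. intros Hx H; now destruct (Rmult_integral _ _ H). Qed.

(** Once [e = 0], component [(2,2,2)] makes rho diagonal with entries [f * (a - d + 1)] and
    [g * (a - d - 1)], and [(2,1,2)] gives [f * g * (a - d) = 0]. The case [f = 0] leads to families
    7 and 8, the other to family 9. *)
Lemma classify_normalized a b c d e f g :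
  g <> 0 ->
  (forall l i j, nabla_ricci (mk_data a b c d e f g 0) l i j = 0) ->
  exists m, admissible m /\
    linearly_equivalent (mk_data a b c d e f g 0) (model_data m).
Proof.
  intros Hg H; nabla_ricci_eqs H.
  (* Components [(2,1,2)] and [(2,2,1)] differ, up to sign, by [(e + h) ^ 2], where [e + h] is the
     antisymmetric part of rho; here [h = 0]. *)
  assert (e = 0) by (assert (e * e = 0) by lra; nra); subst e.
  assert (Hb : c * f - b * g = 0) by (apply (Rmult_cancel_0 g); [assumption|lra]).
  destruct (sign_decomposition g c Hg) as (s & eps & Hs & Heps & Hpos & Hgs).
  assert (He : eps <> 0) by (destruct Heps; lra).
  destruct (Req_dec f 0) as [->|Hf].
  - assert (b = 0) by (apply (Rmult_cancel_0 g); [assumption|lra]); subst b.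
    destruct (Req_dec d (-1)) as [->|Hd].
    + exists (M7 a (c / s / 2) eps); split; [simpl; split; trivial; lra|].
      exists s, 0; split; trivial.
      subst g; gauge_eqs.
    + assert (1 + d - a = 0).
      { apply (Rmult_cancel_0 (g * (1 + d))); [|lra].
        apply Rmult_integral_contrapositive; split; lra. }
      replace a with (1 + d) by lra.
      exists (M8 (c / s / 2) (d / 2) eps); split; [simpl; repeat split; trivial; lra|].
      exists s, 0; split; trivial.
      subst g; gauge_eqs.
  - assert (a - d = 0).
    { apply (Rmult_cancel_0 (g * f)); [|lra].
      now apply Rmult_integral_contrapositive. }
    assert (Ha : a = d) by lra; subst a.
    assert (1 + d = 0).
    (* Component [(1,2,2)] is [2 * g * (1 + d)] minus [2 * c] times this off-diagonal entry of
       rho. *)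
    { assert (c * (c * f - b * g) = 0) by (rewrite Hb; ring).
      apply (Rmult_cancel_0 g); [assumption|lra]. }
    assert (Hd : d = -1) by lra; subst d.
    assert (Hb' : b = c * f / (eps * s ^ 2)).
    { apply Rmult_eq_reg_r with g; [|assumption].
      rewrite <- Hgs; field_simplify; trivial; lra. }
    subst b.
    exists (M9 (c / s / 2) (- (f + 1) / 2) eps); split; [simpl; repeat split; trivial; lra|].
    exists s, 0; split; trivial.
    destruct Heps; subst eps g; gauge_eqs.
Qed.

Lemma classify_diagonal a b c d e f h :
  h <> 0 ->
  (forall l i j, nabla_ricci (mk_data a b c d e f 0 h) l i j = 0) ->
  exists m, admissible m /\
    linearly_equivalent (mk_data a b c d e f 0 h) (model_data m).
Proof.
  intros Hh H; nabla_ricci_eqs H.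
  assert (Hr : c * (h - e) = 0) by (apply (Rmult_cancel_0 h); [assumption|lra]).
  assert (Hc : c = 0).
  { destruct (Req_dec c 0) as [|Hc]; [assumption|exfalso].
    apply Rmult_cancel_0 in Hr; [|assumption].
    assert (e = h) by lra; subst e.
    apply Hh, (Rmult_cancel_0 h); [assumption|lra]. }
  subst c.
  assert (h + e = 0) by (apply (Rmult_cancel_0 h); [assumption|lra]).
  assert (e = - h) by lra; subst e.
  assert (2 + a + d = 0) by (apply (Rmult_cancel_0 h); [assumption|lra]).
  assert (d = - 2 - a) by lra; subst d.
  assert (b * h + f * (1 + a) = 0) by (apply (Rmult_cancel_0 h); [assumption|lra]).
  assert (b = - f * (1 + a) / h).
  { apply Rmult_eq_reg_r with h; [field_simplify; [lra|]|]; assumption. }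
  subst b.
  (* The scale [h] turns the last constant into 1, the shear [B = - 2 - a] turns the first into -2,
     and [xi] is then [f - 2 * B]. *)
  exists (M1 (f + 4 + 2 * a)); split; [exact I|].
  exists h, (- 2 - a); split; trivial.
  gauge_eqs.
Qed.

(** When [c = 0], a shear moves [b] by a multiple of [a - d] if [f = 0], and of [1 + f] if
    [d = 1 + a]. Where that factor vanishes, a nonzero [b] can only be rescaled to 1, which produces
    families 6 and 3. *)
Lemma classify_triangular a b c d e f :
  (forall l i j, nabla_ricci (mk_data a b c d e f 0 0) l i j = 0) ->
  ~ (forall l i j k, hnabla_torsion (mk_data a b c d e f 0 0) l i j k = 0) ->
  exists m, admissible m /\
    linearly_equivalent (mk_data a b c d e f 0 0) (model_data m).
Proof.
  intros H HT; nabla_ricci_eqs H.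
  assert (e = 0) by nra; subst e.
  destruct (Req_dec f 0) as [->|Hf].
  - destruct (Req_dec c 0) as [->|Hc].
    + destruct (Req_dec a d) as [<-|Had].
      * destruct (Req_dec b 0) as [->|Hb].
        -- exists (M5 a (a / 2)); split; [exact I|].
           exists 1, 0; split; [lra|]; gauge_eqs.
        -- exists (M6 (a / 2)); split; [exact I|].
           exists (/ b), 0; split; [now apply Rinv_neq_0_compat|]; gauge_eqs.
      * exists (M5 a (d / 2)); split; [exact I|].
        exists 1, (- b / (a - d)); split; [lra|]; gauge_eqs.
    + exists (M4 (c * b - a * d) ((a + d) / 2)); split; [exact I|].
      exists c, a; split; [assumption|]; gauge_eqs.
  - assert (c = 0) by (do 2 (apply (Rmult_cancel_0 f); [assumption|]); lra); subst c.
    assert (Ha : a <> -1).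
    (* The only component of nabla T that can survive is a multiple of [1 + a]. *)
    { intros ->; apply HT; intros [] [] [] []; hexpand; ring. }
    assert (1 + a - d = 0).
    { apply (Rmult_cancel_0 (f * (1 + a))); [|lra].
      apply Rmult_integral_contrapositive; split; lra. }
    assert (d = 1 + a) by lra; subst d.
    destruct (Req_dec f (-1)) as [->|Hf1].
    + destruct (Req_dec b 0) as [->|Hb].
      * exists (M2 a ((a + 2) / 2)); split; [simpl; lra|].
        exists 1, 0; split; [lra|]; gauge_eqs.
      * exists (M3 ((a + 2) / 2)); split; [exact I|].
        exists (/ b), 0; split; [now apply Rinv_neq_0_compat|]; gauge_eqs.
    (* This [delta] solves [eta + 1 - 2 * delta = f], so admissibility is [f <> 0]. *)
    + exists (M2 a ((a + 1 - f) / 2)); split; [simpl; lra|].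
      exists 1, (b / (1 + f)); split; [lra|]; gauge_eqs.
Qed.

Lemma mk_data_eta G :
  G = mk_data (G I1 I1 I1) (G I1 I1 I2) (G I1 I2 I1) (G I1 I2 I2)
        (G I2 I1 I1) (G I2 I1 I2) (G I2 I2 I1) (G I2 I2 I2).
Proof. do 3 (apply functional_extensionality; intros []); reflexivity. Qed.

Lemma classify G :
  (forall l i j, nabla_ricci G l i j = 0) ->
  ~ (forall l i j k, hnabla_torsion G l i j k = 0) ->
  exists m, admissible m /\ linearly_equivalent G (model_data m).
Proof.
  intros H HT.
  destruct (Req_dec (G I2 I2 I1) 0) as [Hg|Hg].
  - assert (HG := mk_data_eta G); rewrite Hg in HG.
    destruct (Req_dec (G I2 I2 I2) 0) as [Hh|Hh].
    + rewrite Hh in HG; rewrite HG in H, HT |- *; now apply classify_triangular.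
    + rewrite HG in H |- *; now apply classify_diagonal.
  (* A shear by [b] adds [b * g] to [h]. *)
  - set (G' := gauge 1 (- G I2 I2 I2 / G I2 I2 I1) G).
    assert (HG' : forall l i j, nabla_ricci G' l i j = 0).
    { intros l i j; unfold G', sum2; rewrite nabla_ricci_shift; unfold sum2.
      rewrite !H; ring. }
    assert (E1 : G' I2 I2 I1 = G I2 I2 I1).
    { unfold G', gauge, jac, jac_inv, sum2; field. }
    assert (E2 : G' I2 I2 I2 = 0).
    { unfold G', gauge, jac, jac_inv, sum2; field; assumption. }
    cut (exists m, admissible m /\ linearly_equivalent G' (model_data m)).
    { intros (m & Hm & HE); exists m; split; [assumption|].
      apply linearly_equivalent_trans with G'; [|assumption].
      exists 1, (- G I2 I2 I2 / G I2 I2 I1); split; [lra|reflexivity]. }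
    rewrite <- E1 in Hg; clearbody G'; clear E1.
    assert (HG := mk_data_eta G'); rewrite E2 in HG; rewrite HG in HG' |- *.
    now apply classify_normalized.
Qed.

(** * Uniqueness of the normal form *)

(** In terms of [A], [u] and [t] the law is polynomial, with [u * A = 1] as the relation to
    remember. The last equation reuses [G' I1 I1 I1], already fixed by the target model, to keep the
    degree low. *)
Lemma gauge_mk_data A B a b c d e f g h G' :
  A <> 0 ->
  (forall i j k, G' i j k = gauge A B (mk_data a b c d e f g h) i j k) ->
  let u := / A in let t := B / A in
  G' I2 I2 I1 = u ^ 2 * g /\
  G' I2 I2 I2 = u * (t * g + h) /\
  G' I1 I2 I1 = u * (c - t * g) /\
  G' I1 I2 I2 = d - t * h + t * c - t ^ 2 * g /\
  G' I2 I1 I1 = u * (e - t * g) /\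
  G' I2 I1 I2 = f - t * h + t * e - t ^ 2 * g /\
  G' I1 I1 I1 = a - t * c - t * e + t ^ 2 * g /\
  G' I1 I1 I2 = A * (b - t * d - t * f + t ^ 2 * h + t * G' I1 I1 I1).
Proof.
  intros HA HG u t; rewrite !HG.
  unfold gauge, jac, jac_inv, sum2, u, t; simpl; repeat split; field; assumption.
Qed.

Lemma model_unique m m' :
  admissible m -> admissible m' ->
  linearly_equivalent (model_data m) (model_data m') -> m = m'.
Proof.
  intros Hm Hm' (A & B & HA & HG).
  assert (Hu : / A <> 0) by now apply Rinv_neq_0_compat.
  assert (HAu : / A * A = 1) by now apply Rinv_l.
  destruct m, m'; simpl in HG; apply gauge_mk_data in HG; trivial;
    revert HG; generalize dependent (/ A); intros u Hu HAu; generalize (B / A); intros t;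
    simpl; intros (E1 & E2 & E3 & E4 & E5 & E6 & E7 & E8);
    simpl in Hm, Hm'; unfold is_sign in Hm, Hm';
    repeat match goal with
      | H : _ /\ _ |- _ => destruct H
      | H : ?eps = 1 \/ _ |- _ => destruct H; subst eps
      end;
    try (exfalso; lra); try (exfalso; nra); try (f_equal; lra).
  (* Family 4 against itself: [xi] is scaled by [A], so [A = 1] must be extracted first. *)
  { assert (u = 1) by lra; subst u.
    assert (t = 0) by lra; subst t.
    assert (A = 1) by lra; subst A.
    f_equal; lra. }
  (* In families 7 to 9, preserving [h = 0] excludes shears and preserving [eps] leaves [u = 1] or
     [u = -1]; the latter is compatible with nonnegative [alpha] only when it vanishes. *)
  all: assert (t = 0) by (apply (Rmult_cancel_0 u); [assumption|lra]); subst t.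
  all: assert (Hu1 : u = 1 \/ u = -1)
    by (destruct (Rmult_integral (u - 1) (u + 1)); [lra|left; lra|right; lra]).
  all: destruct Hu1; subst u; f_equal; lra.
Qed.

Theorem theorem6 :
  (forall G : typeB_data,
     symmetric_surface (typeB G) ->
     ~ parallel_torsion (typeB G) ->
     exists m : model, admissible m /\ linearly_equivalent G (model_data m))
  /\
  (forall m : model, admissible m ->
     forall x : point, in_domain x -> forall i k : idx,
       torsion_coef (typeB (model_data m)) x k = / fst x * model_torsion m k /\
       ricci_coef (typeB (model_data m)) x i k
         = / (fst x) ^ 2 * model_ricci m i k /\
       nabla_torsion_coef (typeB (model_data m)) x i k
         = / (fst x) ^ 2 * model_nabla_torsion m i k)
  /\
  (forall m m' : model, admissible m -> admissible m' -> m <> m' ->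
     ~ linearly_equivalent (model_data m) (model_data m')).
Proof.
  split; [|split].
  - intros G HG HT.
    apply classify; [now apply symmetric_nabla_ricci|].
    intro H; apply HT; intros x Hx l i j k.
    rewrite (homog_nabla_torsion G l i j x Hx), H.
    apply Rmult_0_l.
  - intros; now apply model_invariants.
  - intros m m' Hm Hm' Hne HE; now apply Hne, model_unique.
Qed.
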